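(* Let $p\in[0,1]$, $q>0$, and let $T_n$ be a finite rooted tree of depth $n$ whose leaves are all at generation $n$. For $u\in T_n$ let $\pi_n(u)$ be the probability that $u$ is connected to $\partial T_n(u)$ by an open path under the random cluster measure with parameters $(p,q)$ on $T_n(u)$ with wired boundary condition. If $u\in\partial T_n$, then $\pi_n(u)=1$. If $u\notin\partial T_n$, then $$\varphi_q(\pi_n(u))=\prod_{v\leftarrow u}\varphi_q\big(\gamma\,\pi_n(v)\big),\qquad\text{where }\ \varphi_q(x):=\frac{1-x}{1+(q-1)x}\ \text{ and }\ \gamma=\gamma_{p,q}:=\varphi_q(1-p).$$ Moreover, setting $B_n(u):=-\log\varphi_q(\pi_n(u))$, we have $B_n(u)=+\infty$ if $u\in\partial T_n$ and, if $u\notin\partial T_n$, letting $\beta$ be such that $1-p=e^{-\beta}$, $$B_n(u)=\sum_{v\leftarrow u}\psi_q^{-1}\big(\psi_q(\beta)\,\psi_q(B_n(v))\big),\qquad\text{where }\ \psi_q(x):=\frac{e^x-1}{e^x+q-1}=\varphi_q(e^{-x}).$$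
   Context: Random cluster model. For a finite (multi)graph $G=(V,E)$, $p\in[0,1]$ and $q>0$, the random cluster measure is the probability on $\omega\in\{0,1\}^E$ given by $\mathbb P^G_{p,q}(\omega)=\frac1{Z^G_{p,q}}\,p^{o(\omega)}(1-p)^{f(\omega)}q^{k(\omega)}$, where $o(\omega)=\sum_e\omega_e$ is the number of open edges ($\omega_e=1$), $f(\omega)=\sum_e(1-\omega_e)$ is the number of closed edges, $k(\omega)$ is the number of connected components of the graph with vertex set $V$ and edge set the open edges, and $Z^G_{p,q}$ is the normalizing constant. Notation. $v\leftarrow u$ means that $v$ is a child of $u$. $T_n(u)$ is the subtree of $T_n$ consisting of $u$ and all its descendants, rooted at $u$; $\partial T_n$ and $\partial T_n(u)$ are the sets of vertices of $T_n$ and $T_n(u)$ at generation $n$ of $T_n$. The wired boundary condition means that the model is considered on the graph $\bar T_n(u)$ obtained from $T_n(u)$ by identifying all the vertices of $\partial T_n(u)$ to a single vertex: $\pi_n(u)=\mathbb P^{\bar T_n(u)}_{p,q}(u\leftrightarrow\partial T_n(u))$. Conventions: $\beta\in[0,+\infty]$, $e^{-\infty}=0$, $-\log0=+\infty$, $\psi_q(+\infty)=1$; $\psi_q$ is an increasing bijection from $[0,+\infty]$ to $[0,1]$ and $\psi_q^{-1}$ is its inverse. *)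

(* Defs.v *)
From HB Require Import structures.
From mathcomp Require Import all_boot all_order all_algebra.
From mathcomp Require Import ring lra.
From mathcomp Require Import all_classical all_reals all_analysis.

Set Implicit Arguments.
Unset Strict Implicit.
Unset Printing Implicit Defensive.

Import Order.TTheory GRing.Theory Num.Theory.
Local Open Scope ring_scope.

(* Loops and parallel edges are allowed; the order of the two ends of an edge
   is irrelevant, see [open_adj]. *)
Record mgraph := MGraph {
  mvert : finType;
  medge : finType;
  mends : medge -> mvert * mvert
}.

Definition config (G : mgraph) := {ffun medge G -> bool}.

Definition open_adj (G : mgraph) (w : config G) : rel (mvert G) :=
  fun x y => [exists e, w e && ((mends e == (x, y)) || (mends e == (y, x)))].

Definition n_open (G : mgraph) (w : config G) : nat := (\sum_e w e)%N.
Definition n_closed (G : mgraph) (w : config G) : nat := (\sum_e ~~ w e)%N.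
Definition n_clusters (G : mgraph) (w : config G) : nat :=
  n_comp (open_adj w) [pred x : mvert G | true].

Section RandomCluster.
Variables (R : realType) (p q : R) (G : mgraph).

Definition rc_weight (w : config G) : R :=
  p ^+ n_open w * (1 - p) ^+ n_closed w * q ^+ n_clusters w.

Definition rc_Z : R := \sum_(w : config G) rc_weight w.

Definition rc_prob (A : {set config G}) : R :=
  \sum_(w in A) rc_weight w / rc_Z.

End RandomCluster.

Definition induced (G : mgraph) (A : {set mvert G}) : mgraph :=
  @MGraph {x : mvert G | x \in A}
    {e : medge G | ((mends e).1 \in A) && ((mends e).2 \in A)}
    (fun e => (exist _ (mends (val e)).1 (proj1 (andP (valP e))),
               exist _ (mends (val e)).2 (proj2 (andP (valP e))))).

(* The quotient of [G] identifying all the vertices of [S] to a single one: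
   the vertices are the classes [S] and [[set x]] for [x \notin S], and all
   the edges are kept. *)
Section Identify.
Variables (G : mgraph) (S : {set mvert G}).

Definition ident_block (x : mvert G) : {set mvert G} :=
  if x \in S then S else [set x].

Definition ident_vert : finType :=
  {B : {set mvert G} | B \in [set ident_block x | x : mvert G]}.

Definition ident_class (x : mvert G) : ident_vert :=
  exist _ (ident_block x) (imset_f ident_block (x := x) isT).

Definition identify : mgraph :=
  @MGraph ident_vert (medge G)
    (fun e => (ident_class (mends e).1, ident_class (mends e).2)).

End Identify.

(* A finite rooted tree is given by its parent map. By convention the root is
   its own parent; acyclicity and connectedness amount to the root being
   reached from every vertex by iterating the parent map. *)
Record rtree := RTree {
  tvert :> finType;
  troot : tvert;
  parent : tvert -> tvert;
  parent_troot : parent troot = troot;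
  troot_reached : forall x, fconnect parent x troot
}.

Section Trees.
Variable T : rtree.
Implicit Types u v : T.

Definition child v u : bool := (v != troot T) && (parent v == u).

Definition leaf u : bool := [forall v : T, ~~ child v u].

(* [findex] is the number of iterations of [parent] from [u] to the root. *)
Definition generation u : nat := findex (@parent T) u (troot T).

Definition depth : nat := (\max_(u : T) generation u)%N.

(* Every vertex other than the root stands for the edge to its parent. *)
Definition tree_graph : mgraph :=
  @MGraph T {v : T | v != troot T} (fun e => (val e, parent (val e))).

Definition subtree u : {set mvert tree_graph} :=
  [set v : T | fconnect (@parent T) v u].

Lemma subtree_refl u : u \in subtree u.
Proof. by rewrite inE connect0. Qed.

Definition subtree_graph u : mgraph := induced (subtree u).

Definition subtree_root u : mvert (subtree_graph u) :=
  exist _ u (subtree_refl u).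

Definition subtree_boundary (n : nat) u : {set mvert (subtree_graph u)} :=
  [set v | generation (val v) == n].

Definition wired_graph (n : nat) u : mgraph := identify (subtree_boundary n u).

Definition connected_to_boundary (n : nat) u :
    {set config (wired_graph n u)} :=
  [set w : config (wired_graph n u) |
    [exists b in subtree_boundary n u,
      connect (open_adj w)
        (ident_class (subtree_boundary n u) (subtree_root u))
        (ident_class (subtree_boundary n u) b)]].

Definition pi_wired (R : realType) (p q : R) (n : nat) u : R :=
  rc_prob p q (connected_to_boundary n u).

End Trees.

Section PhiPsi.
Variable R : realType.

Definition phi (q x : R) : R := (1 - x) / (1 + (q - 1) * x).

Definition gamma_pq (p q : R) : R := phi q (1 - p).

(* Only used on [0, +oo]; the value at -oo is arbitrary. *)
Definition psi (q : R) (x : \bar R) : R :=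
  match x with
  | r%:E%E => (expR r - 1) / (expR r + q - 1)
  | +oo%E => 1
  | -oo%E => 0
  end.

(* The inverse of [psi q] from [0, 1] to [0, +oo], see [psi_bij]. *)
Definition psi_inv (q : R) : R -> \bar R :=
  'pinv_(fun=> 0%E) `[0%E, +oo%E]%classic (psi q).

Lemma psi_lt (q : R) (x y : \bar R) : 0 < q ->
  (0 <= x)%E -> (x < y)%E -> psi q x < psi q y.
Proof.
move=> q0; case: x => [x||] //; rewrite ?lee_fin => x0; last by rewrite ltNge leey.
have ex : 1 <= expR x by rewrite -expR0 ler_expR.
have dx : 0 < expR x + q - 1 by lra.
case: y => [y||] //= xy.
  rewrite lte_fin -ltr_expR in xy.
  rewrite ltr_pdivrMr // mulrAC ltr_pdivlMr; last by lra.
  nra.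
by rewrite ltr_pdivrMr //; lra.
Qed.

Lemma psi_bij (q : R) : 0 < q ->
  set_bij `[0%E, +oo%E]%classic `[0, 1]%classic (psi q).
Proof.
move=> q0; have psi0 : psi q 0%E = 0 by rewrite /= expR0 subrr mul0r.
split.
- move=> x /=; rewrite !in_itv /= => /andP[x0 _].
  apply/andP; split.
    move: x0; rewrite le_eqVlt => /orP[/eqP<-|x0]; first by rewrite psi0.
    by apply: ltW; rewrite -psi0; apply: psi_lt.
  have [->//|xNoo] := eqVneq x +oo%E.
  have xoo : (x < +oo)%E by rewrite ltey.
  by apply: ltW; apply: (psi_lt q0 x0 xoo).
- move=> x y; rewrite !inE /= !in_itv /= => /andP[x0 _] /andP[y0 _] xy.
  case: (ltgtP x y) => // h.
    by have := psi_lt q0 x0 h; rewrite xy ltxx.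
  by have := psi_lt q0 y0 h; rewrite xy ltxx.
- move=> y /=; rewrite in_itv /= => /andP[y0]; rewrite le_eqVlt.
  case/orP => [/eqP->|y1]; first by exists +oo%E => //=; rewrite in_itv /= leey.
  have d0 : 0 < 1 - y by lra.
  have t1 : 1 <= (1 + (q - 1) * y) / (1 - y) by rewrite ler_pdivlMr //; nra.
  exists (ln ((1 + (q - 1) * y) / (1 - y)))%:E.
    by rewrite /= in_itv /= leey andbT lee_fin ln_ge0.
  rewrite /= lnK ?posrE; last by lra.
  field; apply/andP; split; first by lra.
  by apply/eqP; nra.
Qed.

End PhiPsi.

(* [lne] is the extended logarithm, with [lne 0 = -oo]. *)
Definition B_wired (R : realType) (p q : R) (T : rtree) (n : nat) (u : T)
    : \bar R :=
  (- lne (phi q (pi_wired p q n u))%:E)%E.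

(* Main.v *)
Require Import Defs.
From HB Require Import structures.
From mathcomp Require Import all_boot all_order all_algebra.
From mathcomp Require Import all_classical all_reals all_analysis.
From mathcomp Require Import ring lra zify.

Import Order.TTheory GRing.Theory Num.Theory.
Local Open Scope ring_scope.

Set Implicit Arguments.
Unset Strict Implicit.
Unset Printing Implicit Defensive.

(** Give every vertex of the tree an independent Bernoulli([p]) bit, read as the
    state of the edge to its parent. A configuration of the wired graph below
    [u] is the restriction of such a field to the strict descendants of [u], so
    every random cluster sum becomes an expectation [Ex p] of a power of [q].

    The number of clusters is a local quantity because the graph is a tree.
    Every cluster avoiding the wired vertex has a unique highest vertex: a
    vertex [x] that is [u] or has a closed edge to its parent, and that does
    not reach generation [n] by an open path going down. Hence
    [k = 1 + [u does not reach] + sep_count u], where [sep_count u] counts such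
    [x] strictly below [u] ([n_clusters_wired]), and [u] is connected to the
    boundary exactly when it reaches generation [n] by going down
    ([connected_to_boundaryE]).

    Let [C(u)] and [S(u)] be the expectations of [q ^ sep_count u] on the events
    that [u] does and does not reach the boundary. Then
    [pi(u) = C(u) / (C(u) + q S(u))], whence
    [phi (pi u) = S(u) / (C(u) + S(u))] ([phi_pi_wired]). Both numerator and
    denominator are expectations of products over the children [v] of [u], whose
    factors depend on disjoint sets of bits. By independence
    ([Ex_prod_children]),
    - [C(u) + S(u)] is the product of
      [p (C(v) + S(v)) + (1 - p) (C(v) + q S(v))],
    - [S(u)] is the product of [p S(v) + (1 - p) (C(v) + q S(v))],

    because a child that does not reach the boundary contributes a cluster of its
    own exactly when its edge is closed, and [u] does not reach the boundary
    exactly when no child is joined to [u] by an open edge and reaches it. The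
    quotient of the two factors is [phi (gamma pi(v))], which is the recursion
    for [pi].

    The recursion for [B] is the logarithm of the recursion for [pi]. As [phi] is
    an involution of [[0, 1]] and [psi x = phi (e^(-x))], one has
    [psi (- log (phi y)) = y] on [[0, 1]]; thus [psi (B v) = pi v],
    [psi beta = gamma], and [- log (phi (gamma pi(v)))] is
    [psi_inv (psi beta * psi (B v))]. *)

(** * Expectations for independent Bernoulli bits *)

Section Bernoulli.
Variables (R : comNzRingType) (p : R) (I : finType).
Implicit Types (w : {ffun I -> bool}) (A B : {set I}) (F G : {ffun I -> bool} -> R).

Definition bern (b : bool) : R := if b then p else 1 - p.

Definition bern_weight (J : finType) (w : {ffun J -> bool}) : R :=
  \prod_j bern (w j).

Definition Ex F : R := \sum_w bern_weight w * F w.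

Lemma eq_Ex F G : F =1 G -> Ex F = Ex G.
Proof. by move=> FG; apply: eq_bigr => w _; rewrite FG. Qed.

Lemma ExD F G : Ex (fun w => F w + G w) = Ex F + Ex G.
Proof. by rewrite -big_split; apply: eq_bigr => w _; rewrite mulrDr. Qed.

Lemma ExZ c F : Ex (fun w => c * F w) = c * Ex F.
Proof. by rewrite big_distrr; apply: eq_bigr => w _ /=; rewrite mulrCA. Qed.

Lemma Ex_prod_coord (f : I -> bool -> R) :
  Ex (fun w => \prod_i f i (w i)) = \prod_i (p * f i true + (1 - p) * f i false).
Proof.
transitivity (\prod_i \sum_b bern b * f i b).
  rewrite bigA_distr_bigA; apply: eq_bigr => w _.
  by rewrite -big_split.
by apply: eq_bigr => i _; rewrite big_bool.
Qed.

Lemma Ex1 : Ex (fun=> 1) = 1.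
Proof.
transitivity (Ex (fun w => \prod_(i : I) 1)); last first.
  by rewrite (Ex_prod_coord (fun _ _ => 1)) big1 // => i _; ring.
by apply: eq_Ex => w; rewrite big1_eq.
Qed.

Definition depends_on A F :=
  forall w w', {in A, w =1 w'} -> F w = F w'.

Lemma depends_onS A B F : A \subset B -> depends_on A F -> depends_on B F.
Proof. by move=> /fintype.subsetP AB dF w w' ww'; apply: dF => i /AB/ww'. Qed.

Definition splice A w w' : {ffun I -> bool} :=
  [ffun i => if i \in A then w i else w' i].

(** The two expectations on the right use independent copies [w] and [w'] of the
    field. Exchanging [w] and [w'] off [A] preserves the joint weight and turns
    [F w * G w'] into [F w * G w]. *)
Lemma Ex_indep A B F G : [disjoint A & B] ->
  depends_on A F -> depends_on B G ->
  Ex (fun w => F w * G w) = Ex F * Ex G.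
Proof.
move=> AB dF dG.
pose swap (x : {ffun I -> bool} * {ffun I -> bool}) :=
  (splice A x.1 x.2, splice A x.2 x.1).
have swapK : involutive swap.
  move=> [w w']; congr pair; apply/ffunP => i; rewrite !ffunE /=;
  by case: ifP => iA; rewrite ?iA.
have split_weight w w' : bern_weight (splice A w w') * bern_weight (splice A w' w) =
    bern_weight w * bern_weight w'.
  rewrite -!big_split; apply: eq_bigr => i _ /=.
  by rewrite !ffunE; case: ifP => // _; rewrite mulrC.
rewrite {2 3}/Ex big_distrlr pair_big /= (reindex_inj (inv_inj swapK)) /=.
(* Multiplying by [1 = Ex 1] introduces the second copy on the left. *)
rewrite -[LHS]mulr1 -Ex1 {1 2}/Ex big_distrlr pair_big /=.
apply: eq_bigr => -[w w'] _ /=.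
rewrite mulr1 [RHS]mulrACA split_weight.
rewrite (dF (splice A w w') w) => [|i iA]; last by rewrite ffunE iA.
rewrite (dG (splice A w' w) w) => [|i iB]; first by rewrite mulrAC.
by rewrite ffunE (disjointFl AB).
Qed.

Lemma Ex_prod_indep (J : finType) (P : pred J) (A : J -> {set I})
    (F : J -> {ffun I -> bool} -> R) :
  (forall j k, P j -> P k -> j != k -> [disjoint A j & A k]) ->
  (forall j, P j -> depends_on (A j) (F j)) ->
  Ex (fun w => \prod_(j | P j) F j w) = \prod_(j | P j) Ex (F j).
Proof.
move=> disj dF.
have -> : Ex (fun w => \prod_(j | P j) F j w) =
    Ex (fun w => \prod_(j <- enum P) F j w).
  by apply: eq_Ex => w; rewrite big_enum.
rewrite -[RHS]big_enum /=.
have := enum_uniq P; have : {subset enum P <= P} by move=> j; rewrite mem_enum.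
elim: (enum P) => [|j s IH] sP /=.
  by move=> _; rewrite big_nil -[RHS]Ex1; apply: eq_Ex => w; rewrite big_nil.
move=> /andP[js us].
have Pj : P j by apply: sP; rewrite inE eqxx.
have {}sP k : k \in s -> P k by move=> ks; apply: sP; rewrite inE ks orbT.
rewrite big_cons -IH // -(@Ex_indep (A j) (\bigcup_(k in s) A k)).
- by apply: eq_Ex => w; rewrite big_cons.
- apply: finset.bigcup_disjoint => k ks.
  apply: disj => //; first exact: sP.
  by apply: contraNneq js => ->.
- exact: dF.
- move=> w w' ww'; rewrite big_seq [RHS]big_seq; apply: eq_bigr => k ks.
  apply: dF; [exact: sP | move=> i iA; apply: ww'].
  by apply/finset.bigcupP; exists k.
Qed.

Lemma Ex_coord (g : bool -> R) i :
  Ex (fun w => g (w i)) = p * g true + (1 - p) * g false.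
Proof.
have := Ex_prod_coord (fun j b => if j == i then g b else 1).
rewrite (bigD1 i) //= eqxx [X in _ * X]big1 => [|j /negPf->]; last by ring.
rewrite mulr1 => <-; apply: eq_Ex => w.
by rewrite (bigD1 i) //= eqxx big1 ?mulr1 // => j /negPf->.
Qed.

Lemma Ex_if i A F G : i \notin A -> depends_on A F -> depends_on A G ->
  Ex (fun w => if w i then F w else G w) = p * Ex F + (1 - p) * Ex G.
Proof.
move=> iA dF dG.
have disj : [disjoint [set i] & A] by rewrite disjoints1.
have dep (g : bool -> R) : depends_on [set i] (fun w => g (w i)).
  by move=> w w' ww'; rewrite (ww' i) ?set11.
have -> : Ex (fun w => if w i then F w else G w) =
    Ex (fun w => (if w i then 1 else 0) * F w + (if w i then 0 else 1) * G w).
  by apply: eq_Ex => w; case: (w i); rewrite ?mul1r ?mul0r ?addr0 ?add0r.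
rewrite ExD (Ex_indep disj (dep (fun b => if b then 1 else 0))) //.
rewrite (Ex_indep disj (dep (fun b => if b then 0 else 1))) //.
rewrite (Ex_coord (fun b => if b then 1 else 0)).
by rewrite (Ex_coord (fun b => if b then 0 else 1)); ring.
Qed.

(** Given its restriction [c] to the image of [h], the field is free elsewhere,
    and there the weights add up to [p + (1 - p) = 1]. *)
Lemma Ex_marginal (E : finType) (h : E -> I) (F : {ffun E -> bool} -> R) :
  injective h ->
  Ex (fun w => F [ffun e => w (h e)]) = \sum_c bern_weight c * F c.
Proof.
move=> h_inj.
rewrite /Ex (partition_big (fun w => [ffun e => w (h e)]) xpredT) //=.
apply: eq_bigr => c _.
rewrite (eq_bigr (fun w => bern_weight w * F c)) => [|w /eqP-> //].
rewrite -big_distrl /=; congr (_ * _).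
(* The indicator that [w] restricts to [c], as a product over coordinates. *)
pose ok i b := [forall e, (h e == i) ==> (b == c e)].
rewrite big_mkcond (eq_bigr (fun w => bern_weight w * \prod_i (ok i (w i))%:R)).
  rewrite [LHS](Ex_prod_coord (fun i b => (ok i b)%:R)).
  rewrite (bigID (fun i => i \in h @: [set: E])) /= [X in _ * X]big1 ?mulr1.
    rewrite big_imset /=; last exact: in2W.
    apply: eq_big => [e|e _]; first by rewrite finset.in_setT.
    have okE b : ok (h e) b = (b == c e).
      apply/forallP/eqP => [/(_ e)|-> e']; first by rewrite eqxx => /eqP.
      by rewrite (inj_eq h_inj); apply/implyP => /eqP->.
    by rewrite !okE; case: (c e); rewrite /= ?mulr1 ?mulr0 ?addr0 ?add0r.
  move=> i iNh.
  have okT b : ok i b.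
    apply/forallP => e; apply/implyP => /eqP he; case/negP: iNh.
    by rewrite -he imset_f.
  by rewrite !okT /=; ring.
move=> w _; case: eqP => [wc|wNc].
  rewrite big1 ?mulr1 // => i _; suff -> : ok i (w i) by [].
  by apply/forallP => e; apply/implyP => /eqP<-; rewrite -wc ffunE.
have /existsP[e ce] : [exists e, w (h e) != c e].
  apply: contra_notT wNc; rewrite negb_exists => /forallP wc.
  by apply/ffunP => e; rewrite ffunE; apply/eqP; have := wc e; rewrite negbK.
rewrite (bigD1 (h e)) //= [ok _ _](_ : _ = false) ?mul0r ?mulr0 //.
by apply/negbTE/forallPn; exists e; rewrite eqxx.
Qed.

End Bernoulli.

Section BernoulliPos.
Variables (R : realDomainType) (p : R) (I : finType).
Hypothesis hp : 0 <= p <= 1.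

Lemma bern_weight_ge0 (J : finType) (w : {ffun J -> bool}) :
  0 <= bern_weight p w.
Proof.
have /andP[p0 p1] := hp.
by apply: prodr_ge0 => j _; rewrite /bern; case: (w j); rewrite ?subr_ge0.
Qed.

Lemma Ex_ge0 (F : {ffun I -> bool} -> R) : (forall w, 0 <= F w) -> 0 <= Ex p F.
Proof. by move=> F0; apply: sumr_ge0 => w _; rewrite mulr_ge0 ?bern_weight_ge0. Qed.

Lemma Ex_gt0 (F : {ffun I -> bool} -> R) : (forall w, 0 < F w) -> 0 < Ex p F.
Proof.
move=> F0; have F_ge0 w : 0 <= F w by exact: ltW.
rewrite lt_neqAle Ex_ge0 // andbT; apply/eqP => /esym/eqP.
rewrite /Ex psumr_eq0 => [/allP F_eq0|w _]; last by rewrite mulr_ge0 ?bern_weight_ge0.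
have := Ex1 p I; rewrite /Ex big1 => [/eqP|w _]; first by rewrite eq_sym oner_eq0.
have /F_eq0/implyP/(_ isT) : w \in index_enum _ by rewrite mem_index_enum.
by rewrite mulf_eq0 (gt_eqF (F0 w)) orbF => /eqP->; rewrite mul0r.
Qed.

End BernoulliPos.

(** * Descendants in a rooted tree *)

Section TreeOrder.
Variable T : rtree.
Implicit Types (u v x y : T).

Local Notation desc := (fconnect (@parent T)).
Definition sdesc x u := (x != u) && desc x u.

Lemma generation_parent x : x != troot T -> generation x = (generation (parent x)).+1.
Proof. by rewrite eq_sym; apply: fconnect_findex (troot_reached x). Qed.

Lemma generation_child v u : child v u -> generation v = (generation u).+1.
Proof. by case/andP => /generation_parent-> /eqP->. Qed.

Lemma parent_fixed x : (parent x == x) = (x == troot T).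
Proof.
apply/eqP/eqP => [px|->]; last exact: parent_troot.
apply: contra_eq px => /generation_parent gx.
by apply/eqP => px; move: gx; rewrite px; apply/eqP; rewrite ltn_eqF.
Qed.

Lemma generation_leq_depth x : (generation x <= depth T)%N.
Proof. exact: leq_bigmax. Qed.

Lemma leq_generation_parent x : (generation (parent x) <= generation x)%N.
Proof.
have [->|/generation_parent->] := eqVneq x (troot T); last exact: leqnSn.
by rewrite parent_troot.
Qed.

Lemma desc_generation x u : desc x u -> (generation u <= generation x)%N.
Proof.
move=> /iter_findex <-; elim: (findex _ _ _) => //= k.
by apply: leq_trans; apply: leq_generation_parent.
Qed.

Lemma desc_parent x u : desc x u -> x != u -> x != troot T /\ desc (parent x) u.
Proof.
rewrite fconnect_eqVf => /orP[/eqP->|pxu xu]; first by rewrite eqxx.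
split=> //; apply: contraNneq xu => xr.
move: pxu; rewrite xr parent_troot => /iter_findex <-.
by rewrite iter_fix // parent_troot.
Qed.

Lemma child_desc v u : child v u -> desc v u.
Proof. by case/andP => _ /eqP <-; apply: fconnect1. Qed.

Lemma desc_generation_eq x u : desc x u -> generation x = generation u -> x = u.
Proof.
move=> xu gxu; apply/eqP; apply: contra_eqT gxu => xNu.
have [xr /desc_generation] := desc_parent xu xNu.
by rewrite (generation_parent xr) neq_ltn ltnS => ->; rewrite orbT.
Qed.

Lemma sdesc_generation x u : sdesc x u -> (generation u < generation x)%N.
Proof.
case/andP => xNu xu; rewrite ltn_neqAle desc_generation // andbT.
by apply: contraNneq xNu => gxu; apply/eqP/desc_generation_eq.
Qed.

Lemma sdesc_nroot x u : sdesc x u -> x != troot T.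
Proof. by case/andP => xu xDu; have [] := desc_parent xDu xu. Qed.

Lemma sdesc_parent x u : sdesc x u -> desc (parent x) u.
Proof. by case/andP => xu xDu; have [] := desc_parent xDu xu. Qed.

Lemma child_sdesc v u : child v u -> sdesc v u.
Proof.
move=> vu; rewrite /sdesc child_desc // andbT.
by apply: contra_eqN (generation_child vu) => /eqP->; rewrite ltn_eqF.
Qed.

Lemma sdesc_trans x v u : desc x v -> sdesc v u -> sdesc x u.
Proof.
move=> xv vu; have /andP[_ vDu] := vu.
rewrite /sdesc (connect_trans xv vDu) andbT.
apply: contraTneq (sdesc_generation vu) => <-.
by rewrite -leqNgt desc_generation.
Qed.

Lemma ancestor_unique x v v' :
  desc x v -> desc x v' -> generation v = generation v' -> v = v'.
Proof.
move=> /iter_findex <- /iter_findex <-.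
set i := findex _ _ _; set j := findex _ _ _.
wlog ij : i j / (i <= j)%N => [hw|] gij.
  by case: (leqP i j) => [|/ltnW] ij; [|symmetry]; apply: hw.
apply: desc_generation_eq => //.
by rewrite -(subnK ij) iterD; apply: fconnect_iter.
Qed.

Lemma sdesc_child x u : sdesc x u -> exists2 v, child v u & desc x v.
Proof.
have [k] := ubnP (generation x); elim: k x => // k IH x xk xu.
have [pu|pNu] := eqVneq (parent x) u.
  by exists x; rewrite ?connect0 // /child (sdesc_nroot xu) pu eqxx.
have [||v vu pxv] := IH (parent x).
- by rewrite -ltnS -generation_parent // (sdesc_nroot xu).
- by rewrite /sdesc pNu (sdesc_parent xu).
by exists v => //; apply: connect_trans pxv; apply: fconnect1.
Qed.

Lemma children_disjoint x u v v' :
  child v u -> child v' u -> desc x v -> desc x v' -> v = v'.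
Proof.
move=> vu v'u xv xv'; apply: (ancestor_unique xv xv').
by rewrite (generation_child vu) (generation_child v'u).
Qed.

(** Every strict descendant of [u] descends from exactly one child of [u]. *)
Lemma sum_sdesc (f : T -> nat) u :
  (\sum_(x | sdesc x u) f x =
   \sum_(v | child v u) (f v + \sum_(x | sdesc x v) f x))%N.
Proof.
pose branch x := odflt u [pick v | child v u && desc x v].
have branchP x v : child v u -> desc x v -> branch x = v.
  move=> vu xv; rewrite /branch; case: pickP => [v' /andP[v'u xv']|/(_ v)] /=.
    exact: (children_disjoint v'u vu xv' xv).
  by rewrite vu xv.
rewrite (partition_big branch (fun v => child v u)) => [|x /sdesc_child[v vu xv]].
  apply: eq_bigr => v vu.
  rewrite (bigD1 v) /=; last by rewrite child_sdesc // (branchP v v) ?connect0 /=.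
  congr (_ + _)%N; apply: eq_bigl => x.
  apply/andP/andP => [[/andP[xu /eqP bx] xv]|[xNv xv]].
    split=> //; have [v' v'u xv'] := sdesc_child xu.
    by rewrite -bx (branchP x v').
  by rewrite (sdesc_trans xv (child_sdesc vu)) (branchP x v) ?eqxx.
by rewrite (branchP x v).
Qed.

End TreeOrder.

(** * Reaching the boundary by going down *)

Section Reach.
Variables (T : rtree) (n : nat).
Implicit Types (u v x y : T) (w : T -> bool).

Definition up w x := if w x then parent x else x.

Definition reach w x :=
  [exists b : T, (generation b == n) && fconnect (up w) b x].

(** In the wired graph of a subtree having [x] strictly below its root, this is
    the indicator that [x] is the highest vertex of a cluster that avoids the
    wired vertex. *)
Definition isolated_top w x : nat := ~~ w x && ~~ reach w x.

Definition sep_count w u : nat := (\sum_(x | sdesc x u) isolated_top w x)%N.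

Lemma up_desc w x y : fconnect (up w) x y -> fconnect (@parent T) x y.
Proof.
move=> /iter_findex <-; elim: (findex (up w) x y) => //= k /connect_trans; apply.
by rewrite {2}/up; case: (w _); rewrite ?connect0 ?fconnect1.
Qed.

Lemma reachE w x :
  reach w x = (generation x == n) || [exists v, [&& child v x, w v & reach w v]].
Proof.
apply/existsP/orP => [[b /andP[bn /iter_findex]]|].
  move: (findex _ _ _) => k; elim: k x => [x <-|k IH x /=]; first by left.
  set y := iter _ _ b => upy.
  have [wy|wNy] := boolP (w y); last first.
    by apply: IH; rewrite -upy /up (negPf wNy).
  move: upy; rewrite /up wy => pyx.
  have [yr|yNr] := eqVneq y (troot T).
    by apply: IH; rewrite -/y -pyx yr parent_troot.
  right; apply/existsP; exists y; rewrite wy /child yNr pyx eqxx /=.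
  by apply/existsP; exists b; rewrite bn fconnect_iter.
case=> [xn|/existsP[v /and3P[/andP[_ /eqP <-] wv /existsP[b /andP[bn bv]]]]].
  by exists x; rewrite xn connect0.
exists b; rewrite bn; apply: connect_trans bv _.
by have := fconnect1 (up w) v; rewrite {2}/up wv.
Qed.

Lemma eq_reach w w' u :
  (forall x, sdesc x u -> w x = w' x) -> reach w u = reach w' u.
Proof.
have [k] := ubnP (depth T - generation u); elim: k u => // k IH u uk ww'.
rewrite !reachE; congr (_ || _); apply: eq_existsb => v.
have [vu /=|//] := boolP (child v u).
rewrite ww' ?child_sdesc //; congr (_ && _); apply: IH => [|x xv].
  have := generation_leq_depth v; rewrite (generation_child vu); lia.
by apply: ww'; case/andP: xv => _ xv; apply: sdesc_trans xv (child_sdesc vu).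
Qed.

Lemma eq_isolated_top w w' u :
  (forall x, fconnect (@parent T) x u -> w x = w' x) -> isolated_top w u = isolated_top w' u.
Proof.
move=> ww'; rewrite /isolated_top ww' ?connect0 // (@eq_reach w w') // => x.
by case/andP => _ /ww'.
Qed.

Lemma eq_sep_count w w' u :
  (forall x, sdesc x u -> w x = w' x) -> sep_count w u = sep_count w' u.
Proof.
move=> ww'; apply: eq_bigr => x xu; apply: eq_isolated_top => y yx.
exact/ww'/(sdesc_trans yx).
Qed.

Lemma not_reach w u : generation u != n ->
  ~~ reach w u = [forall (v | child v u), ~~ (w v && reach w v)].
Proof.
move=> /negPf un; rewrite reachE un /= negb_exists.
by apply: eq_forallb => v; rewrite negb_and implybE.
Qed.

End Reach.

(** * Clusters of the wired graph *)

(** If [f] is a complete invariant of connectedness, components are counted by its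
    values. The parametrization [c] of the vertices may be many-to-one, so the
    vertices of a quotient can be handled through representatives. *)
Lemma n_comp_codom (V : finType) (e : rel V) (X Y : finType)
    (c : X -> V) (f : X -> Y) (D : {set X}) :
  connect_sym e -> (forall v, exists2 x, x \in D & c x = v) ->
  {in D &, forall x y, connect e (c x) (c y) = (f x == f y)} ->
  n_comp e [pred v : V | true] = #|f @: D|.
Proof.
move=> e_sym c_onto conn_f.
have -> : n_comp e [pred v : V | true] = #|[set fingraph.root e (c x) | x in D]|.
  apply: eq_card => v; rewrite !inE andbT.
  apply/eqP/imsetP => [rv|[x _ ->]]; last exact: (fingraph.root_root e_sym).
  by have [x xD cx] := c_onto v; exists x; rewrite // cx rv.
have [->|[x0 x0D]] := set_0Vmem D; first by rewrite !finset.imset0 !cards0.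
pose pre y := odflt x0 [pick x in D | f x == y].
have preP x : x \in D -> pre (f x) \in D /\ f (pre (f x)) = f x.
  move=> xD; rewrite /pre; case: pickP => [y /andP[yD /eqP]|/(_ x)] //=.
  by rewrite xD eqxx.
have -> : [set fingraph.root e (c x) | x in D] = (fun y => fingraph.root e (c (pre y))) @: (f @: D).
  apply/setP => v; apply/imsetP/imsetP => [[x xD ->]|[_ /imsetP[x xD ->] ->]].
    exists (f x); first exact: imset_f.
    have [pD fp] := preP x xD.
    by apply/eqP; rewrite root_connect // conn_f // fp.
  by exists (pre (f x)) => //; have [] := preP x xD.
apply: card_in_imset => _ _ /imsetP[x xD ->] /imsetP[y yD ->] /eqP.
have [pxD fx] := preP x xD; have [pyD fy] := preP y yD.
by rewrite root_connect // conn_f // fx fy => /eqP.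
Qed.

Lemma open_adj_sym (G : mgraph) (c : config G) : symmetric (open_adj c).
Proof.
by move=> x y; apply: eq_existsb => e; rewrite [_ || _]orbC.
Qed.

Section WiredClusters.
Variables (T : rtree) (n : nat) (u : T).
Implicit Types (x y : T) (w : T -> bool).

Local Notation desc := (fconnect (@parent T)).
Local Notation W := (wired_graph n u).

Definition edge_vertex (e : medge W) : T := val (val e).

Definition restrict_config w : config W := [ffun e => w (edge_vertex e)].

Lemma edge_vertex_inj : injective edge_vertex.
Proof. by move=> e f /val_inj/val_inj. Qed.

Lemma edge_vertex_sdesc e : sdesc (edge_vertex e) u.
Proof.
have /andP[] := valP e; rewrite !inE /= => eu peu.
rewrite /sdesc eu andbT; apply/eqP => /(congr1 (@generation T)) eu'.
have := desc_generation peu; rewrite -eu'.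
by rewrite (generation_parent (valP (val e))) ltnn.
Qed.

Lemma edge_vertex_onto x : sdesc x u -> exists e, edge_vertex e = x.
Proof.
move=> xu; have xr := sdesc_nroot xu; have /andP[_ xDu] := xu.
have eP : (x \in subtree u) && (parent x \in subtree u).
  by rewrite !inE xDu sdesc_parent.
by exists (exist _ (exist _ x xr : medge (tree_graph T)) eP).
Qed.

(** Defined on the whole tree, with a junk value off the subtree of [u], so as to
    avoid carrying membership proofs. *)
Definition wired_class x : mvert W :=
  ident_class (subtree_boundary n u)
    (insubd (subtree_root u : {x : mvert (tree_graph T) | x \in subtree u}) x).

Lemma insubd_subtree x (xu : x \in subtree u) :
  insubd (subtree_root u : {x : mvert (tree_graph T) | x \in subtree u}) x
  = exist _ x xu.
Proof. by apply: val_inj; rewrite val_insubd xu. Qed.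

Lemma wired_class_exist x (xu : x \in subtree u) :
  ident_class (subtree_boundary n u) (exist _ x xu) = wired_class x.
Proof. by rewrite /wired_class insubd_subtree. Qed.

Lemma wired_class_onto (B : mvert W) : exists2 x, desc x u & wired_class x = B.
Proof.
case: B => B BP; have /imsetP[[x xu] _ Bx] := BP.
exists x; first by move: (xu); rewrite inE.
by apply: val_inj; rewrite -(wired_class_exist xu) /= Bx.
Qed.

Lemma wired_class_eq x y : desc x u -> desc y u ->
  (wired_class x == wired_class y) =
  (x == y) || (generation x == n) && (generation y == n).
Proof.
move=> xDu yDu.
have xu : x \in subtree u by rewrite inE.
have yu : y \in subtree u by rewrite inE.
rewrite -(wired_class_exist xu) -(wired_class_exist yu) -val_eqE /= /ident_block !inE /=.
set X := exist _ x xu; set Y := exist _ y yu.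
have memX : (X \in subtree_boundary n u) = (generation x == n) by rewrite inE.
have memY : (Y \in subtree_boundary n u) = (generation y == n) by rewrite inE.
have XY : (X == Y) = (x == y) by rewrite -val_eqE.
rewrite -memX -memY -XY.
case: ifP => XB; case: ifP => YB /=; rewrite ?eqxx ?orbT ?orbF ?(inj_eq (@set1_inj _)) //.
- have -> : (X == Y) = false by apply: contraFF YB => /eqP<-.
  by apply: contraFF YB => /eqP SY; rewrite SY set11.
- have -> : (X == Y) = false by apply: contraFF XB => /eqP->.
  by apply: contraFF XB => /eqP SX; rewrite -SX set11.
Qed.

Lemma mends_wired e :
  mends e = (wired_class (edge_vertex e), wired_class (parent (edge_vertex e))).
Proof. by congr pair; rewrite /= wired_class_exist. Qed.

Section Config.
Variable w : T -> bool.

(** The configuration with the edge above [u] closed: following its open edges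
    upwards stays in the subtree of [u]. *)
Definition capped x := w x && (x != u).
Local Notation step := (up capped).
Local Notation c := (restrict_config w).

(** An upward path has at most [depth T] steps, after which iteration is
    stationary ([step_top]). *)
Definition top x := iter (depth T) step x.

(** [None] stands for the cluster of the wired vertex; every other cluster is
    named by its highest vertex. *)
Definition cluster_id x := if reach n capped (top x) then None else Some (top x).

Lemma desc_step x : desc x u -> desc (step x) u.
Proof.
move=> xu; rewrite /up /capped; case: andP => // -[_ xNu].
by have [] := desc_parent xu xNu.
Qed.

Lemma desc_iter_step k x : desc x u -> desc (iter k step x) u.
Proof. by move=> xu; elim: k => //= k; apply: desc_step. Qed.

Lemma step_top x : step (top x) = top x.
Proof.
rewrite /top; have := generation_leq_depth x.
elim: (depth T) x => [|k IH] x xk.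
  have xr : x == troot T by move: xk; rewrite leqn0 /generation findex_eq0.
  by rewrite /= /up (eqP xr) parent_troot; case: ifP.
rewrite iterSr.
have [fx|sx] := eqVneq (step x) x; first by rewrite fx iter_fix.
apply: IH; move: sx; rewrite /up; case: ifP; rewrite ?eqxx // => _.
by rewrite parent_fixed => xr; rewrite -ltnS -generation_parent.
Qed.

Lemma top_step x : top (step x) = top x.
Proof. by rewrite /top -iterSr iterS step_top. Qed.

Lemma reach_capped x : desc x u -> reach n capped x = reach n w x.
Proof.
move=> xu; apply: eq_reach => y yx; rewrite /capped.
have [/eqP yu|] := eqVneq y u; last by rewrite andbT.
have := sdesc_generation yx; rewrite (eqP yu) => ux.
by have := desc_generation xu; rewrite leqNgt ux.
Qed.

Lemma cluster_id_boundary x : generation x = n -> cluster_id x = None.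
Proof.
move=> xn; rewrite /cluster_id ifT //; apply/existsP; exists x.
by rewrite xn eqxx fconnect_iter.
Qed.

Lemma cluster_id_class x y : desc x u -> desc y u ->
  wired_class x = wired_class y -> cluster_id x = cluster_id y.
Proof.
move=> xu yu /eqP; rewrite wired_class_eq // => /orP[/eqP-> //|/andP[/eqP xn /eqP yn]].
by rewrite !cluster_id_boundary.
Qed.

Lemma connect_open_sym : connect_sym (open_adj c).
Proof. exact/sym_connect_sym/open_adj_sym. Qed.

Lemma connect_cluster_id x y : desc x u -> desc y u ->
  connect (open_adj c) (wired_class x) (wired_class y) -> cluster_id x = cluster_id y.
Proof.
move=> xu yu.
(* A set of wired vertices, closed under open adjacency, that contains the
   class of [x]. *)
pose a := [pred B | [exists z, [&& desc z u, wired_class z == B & cluster_id z == cluster_id x]]].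
have aE z : desc z u -> (wired_class z \in a) = (cluster_id z == cluster_id x).
  move=> zu; rewrite inE; apply/existsP/idP => [[z' /and3P[z'u /eqP zz' /eqP<-]]|zx].
    by rewrite (cluster_id_class zu z'u).
  by exists z; rewrite zu eqxx.
have a_closed : closed_mem (open_adj c) (mem a).
  apply: (intro_closed connect_open_sym) => B C /existsP[e /andP[]].
  rewrite ffunE mends_wired => we.
  set z := edge_vertex e in we *.
  have zs : sdesc z u := edge_vertex_sdesc e.
  have [zNu zu] := andP zs; have pzu := sdesc_parent zs.
  have idp : cluster_id (parent z) = cluster_id z.
    rewrite /cluster_id -(_ : step z = parent z) ?top_step //.
    by rewrite /up /capped we zNu.
  by case/orP => /eqP[<- <-]; rewrite !aE // idp.
move=> /(closed_connect a_closed); rewrite !aE // eqxx.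
by move=> /esym/eqP.
Qed.

Lemma connect_step x : desc x u ->
  connect (open_adj c) (wired_class x) (wired_class (step x)).
Proof.
move=> xu; have [cx|cx] := boolP (capped x); last by rewrite /up (negPf cx).
rewrite /up cx; have /andP[wx xNu] := cx.
have [|e ex] := @edge_vertex_onto x; first by rewrite /sdesc xNu.
apply/connect1/existsP; exists e.
by rewrite ffunE mends_wired ex wx eqxx.
Qed.

Lemma connect_fconnect x y : desc x u -> fconnect step x y ->
  connect (open_adj c) (wired_class x) (wired_class y).
Proof.
move=> xu /iter_findex <-; move: (findex _ _ _) => k.
elim: k => //= k /connect_trans; apply.
exact/connect_step/desc_iter_step.
Qed.

Lemma connect_top x : desc x u ->
  connect (open_adj c) (wired_class x) (wired_class (top x)).
Proof. by move=> xu; apply: connect_fconnect; rewrite ?fconnect_iter. Qed.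

Lemma cluster_id_None x : desc x u -> cluster_id x = None ->
  exists b, [/\ desc b u, generation b = n &
    connect (open_adj c) (wired_class x) (wired_class b)].
Proof.
move=> xu; rewrite /cluster_id; case: ifP => // /existsP[b /andP[/eqP bn bx]] _.
have bu : desc b u := connect_trans (up_desc bx) (desc_iter_step _ xu).
exists b; split=> //; apply: connect_trans (connect_top xu) _.
by rewrite connect_open_sym connect_fconnect.
Qed.

Lemma cluster_id_connect x y : desc x u -> desc y u ->
  cluster_id x = cluster_id y ->
  connect (open_adj c) (wired_class x) (wired_class y).
Proof.
move=> xu yu xy; case idx: (cluster_id x) => [t|].
  have top_eq z : cluster_id z = Some t -> top z = t.
    by rewrite /cluster_id; case: ifP => // _ [].
  apply: connect_trans (connect_top xu) _.
  by rewrite top_eq // -(top_eq y) -?xy // connect_open_sym connect_top.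
have [b [bu bn xb]] := cluster_id_None xu idx.
have [|b' [b'u b'n yb']] := cluster_id_None yu; first by rewrite -xy.
apply: connect_trans xb _; rewrite connect_open_sym; apply: connect_trans yb' _.
by rewrite [X in connect _ X _](_ : _ = wired_class b) //; apply/eqP;
   rewrite wired_class_eq // b'n bn eqxx orbT.
Qed.

Lemma top_fixed x : ~~ capped x -> top x = x.
Proof. by move=> cx; rewrite /top iter_fix // /up (negPf cx). Qed.

Lemma capped_top x : desc x u -> ~~ capped (top x).
Proof.
move=> xu; have tu : desc (top x) u by apply: desc_iter_step.
apply/negP => ct; have /andP[_ tNu] := ct.
have /sdesc_nroot/negP[] : sdesc (top x) u by rewrite /sdesc tNu.
by rewrite -parent_fixed; have := step_top x; rewrite {1}/up ct => ->.
Qed.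

Lemma capped_root : capped u = false.
Proof. by rewrite /capped eqxx andbF. Qed.

Variable b0 : T.
Hypotheses (b0u : desc b0 u) (b0n : generation b0 = n).

Lemma cluster_id_image :
  cluster_id @: [set x | desc x u] =
  None |: Some @: [set x | desc x u & ~~ capped x && ~~ reach n w x].
Proof.
apply/setP => t; rewrite !inE; apply/imsetP/orP => [[x]|].
  rewrite inE => xu ->.
  have tu : desc (top x) u by apply: desc_iter_step.
  rewrite /cluster_id reach_capped //; case: ifP => rx; [by left | right].
  by apply: imset_f; rewrite inE tu capped_top // rx.
case=> [/eqP->|/imsetP[x]].
  by exists b0; rewrite ?inE // cluster_id_boundary.
rewrite inE => /and3P[xu cx rx] ->; exists x; first by rewrite inE.
by rewrite /cluster_id top_fixed // reach_capped // (negPf rx).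
Qed.

(** The summand [1] is the cluster of the wired vertex, which exists because of
    [b0]; the next one is the cluster of [u] when it is another one. *)
Lemma n_clusters_wired :
  n_clusters c = (~~ reach n w u + sep_count n w u).+1.
Proof.
rewrite /n_clusters.
rewrite (n_comp_codom (c := wired_class) (f := cluster_id) (D := [set x | desc x u])).
- rewrite cluster_id_image cardsU1 card_imset; last exact: Some_inj.
  rewrite (_ : None \notin _ = true); last by apply/negP => /imsetP[].
  rewrite add1n -sum1_card; congr _.+1.
  rewrite (eq_bigl (fun x => desc x u && (~~ capped x && ~~ reach n w x))); last first.
    by move=> x; rewrite inE.
  rewrite big_mkcondr (bigD1 u) ?connect0 //= capped_root; congr (_ + _)%N.
  rewrite /sep_count; apply: eq_big => [x|x /andP[_ xNu]]; first exact: andbC.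
  by rewrite /isolated_top /capped xNu andbT; case: ifP.
- exact: connect_open_sym.
- by move=> B; have [x xu <-] := wired_class_onto B; exists x; rewrite ?inE.
move=> x y; rewrite !inE => xu yu.
apply/idP/eqP; [exact: connect_cluster_id | exact: cluster_id_connect].
Qed.

Lemma connected_to_boundaryE : (c \in connected_to_boundary n u) = reach n w u.
Proof.
have idu : cluster_id u = if reach n w u then None else Some u.
  by rewrite /cluster_id top_fixed ?capped_root // reach_capped ?connect0.
rewrite inE /subtree_root wired_class_exist.
apply/existsP/idP => [[[b bu] /andP[]]|ru].
  rewrite inE /= wired_class_exist => /eqP bn /connect_cluster_id.
  have bDu : desc b u by move: bu; rewrite inE.
  rewrite idu cluster_id_boundary //; case: (reach n w u) => // H.
  by have := H (connect0 _ _) bDu.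
have [|b [bDu bn ub]] := @cluster_id_None u (connect0 _ _); first by rewrite idu ru.
have bu : b \in subtree u by rewrite inE.
by exists (exist _ b bu); rewrite inE /= wired_class_exist bn eqxx.
Qed.

End Config.
End WiredClusters.

(** * The functions phi and psi *)

Section PhiPsiTheory.
Variables (R : realType) (q : R).
Hypothesis hq : 0 < q.

Lemma phi_den_gt0 (x : R) : 0 <= x <= 1 -> 0 < 1 + (q - 1) * x.
Proof. by have := hq; move=> ? /andP[? ?]; nra. Qed.

Lemma phi_itv (x : R) : 0 <= x <= 1 -> 0 <= phi q x <= 1.
Proof.
move=> hx; have d := phi_den_gt0 hx; have := hq; case/andP: hx => x0 x1 q0.
rewrite /phi divr_ge0 ?(ltW d) ?subr_ge0 //= ler_pdivrMr // mul1r.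
nra.
Qed.

Lemma phiK (x : R) : 0 <= x <= 1 -> phi q (phi q x) = x.
Proof.
move=> hx; have d := phi_den_gt0 hx; rewrite {1}/phi.
have -> : 1 - phi q x = q * x / (1 + (q - 1) * x) by rewrite /phi; field; lra.
have -> : 1 + (q - 1) * phi q x = q / (1 + (q - 1) * x) by rewrite /phi; field; lra.
by field; rewrite !gt_eqF.
Qed.

Lemma psi_expeR (x : \bar R) : (0 <= x)%E -> psi q x = phi q (fine (expeR (- x)%E)).
Proof.
case: x => [r||] //; last by rewrite /= /phi mulr0 subr0 addr0 divr1.
rewrite lee_fin => r0 /=; rewrite expRN /phi.
have e1 : 1 <= expR r by rewrite -expR0 ler_expR.
have := hq => q0.
by field; apply/andP; split; apply/eqP; lra.
Qed.

Lemma oppe_lne_ge0 (y : R) : 0 <= y <= 1 -> (0 <= - lne y%:E)%E.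
Proof. by case/andP => _ y1; rewrite oppe_ge0 lne_le0 lee_fin. Qed.

Lemma psi_oppe_lne (y : R) : 0 <= y <= 1 -> psi q (- lne y%:E)%E = phi q y.
Proof.
move=> hy; rewrite psi_expeR ?oppe_lne_ge0 // oppeK lneK //.
by case/andP: hy => y0 _; rewrite in_itv /= lee_fin y0 leey.
Qed.

Lemma psi_inv_phi (y : R) : 0 <= y <= 1 -> psi_inv q (phi q y) = (- lne y%:E)%E.
Proof.
move=> hy; rewrite -psi_oppe_lne // /psi_inv pinvKV //.
  by have [_ inj _] := psi_bij hq.
by rewrite inE /= in_itv /= oppe_lne_ge0 // leey.
Qed.

Lemma psi_inv_itv (y : R) : 0 <= y <= 1 -> psi_inv q y = (- lne (phi q y)%:E)%E.
Proof. by move=> hy; rewrite -{1}(phiK hy) psi_inv_phi // phi_itv. Qed.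

End PhiPsiTheory.

Lemma oppe_lneM (R : realType) (a b : R) : 0 <= a <= 1 -> 0 <= b <= 1 ->
  (- lne (a * b)%:E = - lne a%:E + - lne b%:E)%E.
Proof.
move=> /andP[+ _] /andP[+ _].
rewrite le_eqVlt => /orP[/eqP<-|a0]; rewrite le_eqVlt => /orP[/eqP<-|b0];
  rewrite ?mul0r ?mulr0 ?(@le0_lneNy _ 0%:E) //.
- by rewrite lne_EFin.
- by rewrite lne_EFin.
- by rewrite !lne_EFin ?mulr_gt0 // lnM ?posrE // -!EFinN -EFinD opprD.
Qed.

(** All terms lie in [[0, +oo]], so the sum is well behaved even when some factor
    vanishes. *)
Lemma oppe_lne_prod (R : realType) (J : finType) (P : pred J) (f : J -> R) :
  (forall j, P j -> 0 <= f j <= 1) ->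
  (- lne (\prod_(j | P j) f j)%:E = \sum_(j | P j) - lne (f j)%:E)%E.
Proof.
move=> f01.
pose K (x : R) (y : \bar R) := (0 <= x <= 1) /\ (- lne x%:E = y)%E.
suff [] : K (\prod_(j | P j) f j) (\sum_(j | P j) - lne (f j)%:E)%E by [].
apply: (big_ind2 K).
- by split; rewrite ?ler01 ?lexx // lne1 oppe0.
- move=> x1 y1 x2 y2 [h1 <-] [h2 <-]; split; last exact: oppe_lneM.
  by case/andP: h1 => ? ?; case/andP: h2 => ? ?; rewrite mulr_ge0 //= mulr_ile1.
- by move=> j Pj; split; first exact: f01.
Qed.

(** * The recursion *)

Section Recursion.
Variables (R : realType) (p q : R) (T : rtree) (n : nat).
Hypotheses (hp : 0 <= p <= 1) (hq : 0 < q).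
Implicit Types (u v : T) (w : {ffun T -> bool}).

Local Notation desc := (fconnect (@parent T)).
Local Notation E := (Ex p).

Definition conn_weight u w : R := if reach n w u then q ^+ sep_count n w u else 0.
Definition sep_weight u w : R := if reach n w u then 0 else q ^+ sep_count n w u.

Lemma rc_weightE (G : mgraph) (c : config G) :
  rc_weight p q c = bern_weight p c * q ^+ n_clusters c.
Proof.
rewrite /rc_weight /n_open /n_closed !expr_sum -big_split; congr (_ * _).
by apply: eq_bigr => e _ /=; rewrite /bern; case: (c e); rewrite ?mulr1 ?mul1r ?expr1.
Qed.

Lemma conn_weight_ge0 u w : 0 <= conn_weight u w.
Proof. by rewrite /conn_weight; case: ifP => // _; rewrite exprn_ge0 // ltW. Qed.

Lemma sep_weight_ge0 u w : 0 <= sep_weight u w.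
Proof. by rewrite /sep_weight; case: ifP => // _; rewrite exprn_ge0 // ltW. Qed.

Lemma conn_sep_weight u w : conn_weight u w + sep_weight u w = q ^+ sep_count n w u.
Proof. by rewrite /conn_weight /sep_weight; case: ifP; rewrite ?addr0 ?add0r. Qed.

Lemma Ex_conn_ge0 u : 0 <= E (conn_weight u).
Proof. exact/Ex_ge0/conn_weight_ge0. Qed.

Lemma Ex_sep_ge0 u : 0 <= E (sep_weight u).
Proof. exact/Ex_ge0/sep_weight_ge0. Qed.

Lemma Ex_conn_sep_gt0 u : 0 < E (conn_weight u) + E (sep_weight u).
Proof.
rewrite -ExD; apply: Ex_gt0 => // w.
by rewrite conn_sep_weight exprn_gt0.
Qed.

Lemma Ex_conn_qsep_gt0 u : 0 < E (conn_weight u) + q * E (sep_weight u).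
Proof.
rewrite -ExZ -ExD; apply: Ex_gt0 => // w; rewrite /conn_weight /sep_weight.
by case: ifP; rewrite ?mulr0 ?addr0 ?add0r ?mulr_gt0 ?exprn_gt0.
Qed.

(** By [n_clusters_wired] there are [sep_count u + 1] clusters if [u] reaches the
    boundary and [sep_count u + 2] otherwise; the common factor [q] cancels. *)
Lemma pi_wiredE u : (exists2 b, desc b u & generation b = n) ->
  pi_wired p q n u = E (conn_weight u) / (E (conn_weight u) + q * E (sep_weight u)).
Proof.
case=> b bu bn; rewrite /pi_wired /rc_prob -big_distrl /=.
have num : \sum_(c in connected_to_boundary n u) rc_weight p q c =
    q * E (conn_weight u).
  transitivity (\sum_(c : config (wired_graph n u)) bern_weight p c *
      (if c \in connected_to_boundary n u then q ^+ n_clusters c else 0)).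
    rewrite big_mkcond; apply: eq_bigr => c _.
    by case: ifP; rewrite ?rc_weightE ?mulr0.
  rewrite -(Ex_marginal _ _ (@edge_vertex_inj T n u)) -ExZ.
  apply: eq_Ex => w; rewrite connected_to_boundaryE.
  rewrite (n_clusters_wired w bu bn) /conn_weight.
  by case: (reach n w u); rewrite ?mulr0 // add0n exprS.
have den : rc_Z p q (wired_graph n u) =
    q * (E (conn_weight u) + q * E (sep_weight u)).
  transitivity (\sum_(c : config (wired_graph n u))
      bern_weight p c * q ^+ n_clusters c).
    by apply: eq_bigr => c _; apply: rc_weightE.
  rewrite -(Ex_marginal _ _ (@edge_vertex_inj T n u)) -(ExZ p q) -ExD -ExZ.
  apply: eq_Ex => w; rewrite (n_clusters_wired w bu bn) /conn_weight /sep_weight.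
  case: (reach n w u); rewrite /= ?mulr0 ?addr0 ?add0r ?add0n ?exprS //.
have := Ex_conn_qsep_gt0 u; have := hq; rewrite num den => q0 d0.
by field; rewrite !gt_eqF.
Qed.

Lemma pi_wired_itv u : (exists2 b, desc b u & generation b = n) ->
  0 <= pi_wired p q n u <= 1.
Proof.
move=> /pi_wiredE ->; have d := Ex_conn_qsep_gt0 u.
rewrite divr_ge0 ?Ex_conn_ge0 ?(ltW d) //= ler_pdivrMr // mul1r lerDl.
by rewrite mulr_ge0 ?Ex_sep_ge0 // ltW.
Qed.

Lemma phi_pi_wired u : (exists2 b, desc b u & generation b = n) ->
  phi q (pi_wired p q n u) =
  E (sep_weight u) / (E (conn_weight u) + E (sep_weight u)).
Proof.
move=> /pi_wiredE ->; have := Ex_conn_qsep_gt0 u; have := Ex_conn_sep_gt0 u.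
rewrite /phi; set a := E (conn_weight u); set b := E (sep_weight u) => ab aqb.
have q0 := hq.
have den : 1 + (q - 1) * (a / (a + q * b)) = q * (a + b) / (a + q * b).
  by field; rewrite gt_eqF.
by rewrite den; field; rewrite !gt_eqF.
Qed.

Lemma depends_on_conn_weight u : depends_on [set x | sdesc x u] (conn_weight u).
Proof.
move=> w w' ww'; have {}ww' x : sdesc x u -> w x = w' x.
  by move=> xu; apply: ww'; rewrite inE.
by rewrite /conn_weight (eq_reach n ww') (eq_sep_count n ww').
Qed.

Lemma depends_on_sep_weight u : depends_on [set x | sdesc x u] (sep_weight u).
Proof.
move=> w w' ww'; have {}ww' x : sdesc x u -> w x = w' x.
  by move=> xu; apply: ww'; rewrite inE.
by rewrite /sep_weight (eq_reach n ww') (eq_sep_count n ww').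
Qed.

Lemma Ex_prod_children u (F G : T -> {ffun T -> bool} -> R) :
  (forall v, depends_on [set x | sdesc x v] (F v)) ->
  (forall v, depends_on [set x | sdesc x v] (G v)) ->
  E (fun w => \prod_(v | child v u) (if w v then F v w else G v w)) =
  \prod_(v | child v u) (p * E (F v) + (1 - p) * E (G v)).
Proof.
move=> dF dG.
rewrite (@Ex_prod_indep _ _ _ _ _ (fun v => [set x | desc x v])
  (fun v w => if w v then F v w else G v w)).
- apply: eq_bigr => v _; apply: (@Ex_if _ _ _ _ [set x | sdesc x v]) => //.
  by rewrite inE /sdesc eqxx.
- move=> v v' vu v'u; apply: contraNT => /pred0Pn[x /andP[]] /=.
  by rewrite !inE => xv xv'; apply/eqP/(children_disjoint vu v'u xv xv').
move=> v _ w w' ww'.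
have sub : [set x | sdesc x v] \subset [set x | desc x v].
  by apply/fintype.subsetP => x; rewrite !inE => /andP[].
rewrite (ww' v) ?inE ?connect0 //.
by rewrite (depends_onS sub (dF v) ww') (depends_onS sub (dG v) ww').
Qed.

(** Below the child [v] lie the isolated tops counted by [sep_count v], and [v]
    itself is one more when its edge is closed and it does not reach the
    boundary. *)
Lemma q_exp_sep_count u w : q ^+ sep_count n w u =
  \prod_(v | child v u) (if w v then conn_weight v w + sep_weight v w
                         else conn_weight v w + q * sep_weight v w).
Proof.
rewrite /sep_count sum_sdesc expr_sum; apply: eq_bigr => v _.
rewrite -/(sep_count n w v) exprD conn_sep_weight /isolated_top /conn_weight /sep_weight.
case: (w v) => /=; first by rewrite mul1r.
by case: (reach n w v) => /=; rewrite ?mulr0 ?addr0 ?add0r ?mul1r ?expr1.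
Qed.

(** As in [q_exp_sep_count], except that the terms in which some child is joined
    to [u] and reaches the boundary vanish. The generation matters: at a
    leaf of generation [n] the left side is [0] and the right side is an empty
    product. *)
Lemma sep_weight_children u w : generation u != n -> sep_weight u w =
  \prod_(v | child v u) (if w v then sep_weight v w
                         else conn_weight v w + q * sep_weight v w).
Proof.
move=> /(not_reach w); rewrite {1}/sep_weight; case: ifPn => [_ /esym/negbT|_ /esym/forallP nr].
  rewrite negb_forall => /existsP[v].
  rewrite negb_imply negbK => /and3P[vu wv rv].
  by rewrite (bigD1 v) //= wv /sep_weight rv mul0r.
rewrite q_exp_sep_count; apply: eq_bigr => v vu.
have := nr v; rewrite vu /= negb_and /conn_weight /sep_weight.
by case: (w v) => //= /negPf->; rewrite add0r.
Qed.

Hypothesis boundary_below : forall u, exists2 b, desc b u & generation b = n.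

(** With [C], [S] for the two expectations at [v] and [d = 1 + (q - 1) (1 - p)], one
    has [gamma = p / d] and [pi = C / (C + q S)]; the common factor
    [d (C + q S)] clears the fraction. *)
Lemma phi_pi_wired_child v :
  phi q (gamma_pq p q * pi_wired p q n v) =
  (p * E (sep_weight v) + (1 - p) * (E (conn_weight v) + q * E (sep_weight v))) /
  (p * (E (conn_weight v) + E (sep_weight v)) +
   (1 - p) * (E (conn_weight v) + q * E (sep_weight v))).
Proof.
rewrite (pi_wiredE (boundary_below v)).
have := Ex_conn_qsep_gt0 v; have := Ex_conn_sep_gt0 v.
rewrite /phi; set a := E (conn_weight v); set b := E (sep_weight v) => ab aqb.
have q0 := hq; have /andP[p0 p1] := hp.
have g0 : 0 < 1 + (q - 1) * (1 - p) by nra.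
have d0 : 0 < p * (a + b) + (1 - p) * (a + q * b).
  have [->|pN0] := eqVneq p 0; first by rewrite mul0r add0r subr0 mul1r.
  rewrite ltr_wpDr ?mulr_ge0 ?subr_ge0 ?(ltW aqb) // mulr_gt0 //.
  by rewrite lt_neqAle eq_sym pN0.
have -> : gamma_pq p q = p / (1 + (q - 1) * (1 - p)).
  by rewrite /gamma_pq /phi; congr (_ / _); ring.
have den : 1 + (q - 1) * (p / (1 + (q - 1) * (1 - p)) * (a / (a + q * b))) =
  q * (p * (a + b) + (1 - p) * (a + q * b)) /
  ((1 + (q - 1) * (1 - p)) * (a + q * b)).
  by field; rewrite !gt_eqF.
by rewrite den; field; rewrite !gt_eqF.
Qed.

Lemma phi_pi_wired_rec u : generation u != n ->
  phi q (pi_wired p q n u) =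
  \prod_(v | child v u) phi q (gamma_pq p q * pi_wired p q n v).
Proof.
move=> un; rewrite (phi_pi_wired (boundary_below u)) -ExD.
under eq_bigr do rewrite phi_pi_wired_child.
have dC v := @depends_on_conn_weight v; have dS v := @depends_on_sep_weight v.
have dD v (k : R) : depends_on [set x | sdesc x v]
    (fun w => conn_weight v w + k * sep_weight v w).
  by move=> w w' ww'; rewrite (dC _ _ _ ww') (dS _ _ _ ww').
rewrite prodf_div; congr (_ / _).
  rewrite (eq_Ex _ (fun w => sep_weight_children w un)) Ex_prod_children //.
  by apply: eq_bigr => v _; rewrite ExD ExZ.
have eqE w : conn_weight u w + sep_weight u w = \prod_(v | child v u)
    (if w v then conn_weight v w + 1 * sep_weight v w
     else conn_weight v w + q * sep_weight v w).
  by rewrite conn_sep_weight q_exp_sep_count; apply: eq_bigr => v _; rewrite mul1r.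
rewrite (eq_Ex _ eqE) Ex_prod_children //.
by apply: eq_bigr => v _; rewrite !ExD !ExZ mul1r.
Qed.

Lemma pi_wired_boundary u : generation u = n -> pi_wired p q n u = 1.
Proof.
move=> un; rewrite pi_wiredE //; have := Ex_conn_sep_gt0 u.
have -> : E (sep_weight u) = 0.
  by rewrite /Ex big1 // => w _; rewrite /sep_weight reachE un eqxx mulr0.
by rewrite mulr0 addr0 => a0; rewrite divff // gt_eqF.
Qed.

Lemma B_wired_rec (beta : \bar R) u : (0 <= beta)%E ->
  (1 - p)%:E = expeR (- beta)%E -> generation u != n ->
  B_wired p q n u = (\sum_(v : T | child v u)
    psi_inv q (psi q beta * psi q (B_wired p q n v)))%E.
Proof.
move=> beta0 hbeta un; have p01 : 0 <= 1 - p <= 1 by case/andP: hp => ? ?; lra.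
have g01 := phi_itv hq p01.
have gpi v : 0 <= gamma_pq p q * pi_wired p q n v <= 1.
  case/andP: g01 => g0 g1; have /andP[x0 x1] := pi_wired_itv (boundary_below v).
  by rewrite mulr_ge0 //= mulr_ile1.
rewrite /B_wired phi_pi_wired_rec // oppe_lne_prod => [|v _]; last exact: phi_itv.
apply: eq_bigr => v _.
have pi01 := pi_wired_itv (boundary_below v).
rewrite (psi_oppe_lne hq (phi_itv hq pi01)) phiK // psi_expeR // -hbeta /=.
by rewrite psi_inv_itv.
Qed.

End Recursion.

Lemma boundary_below (T : rtree) (n : nat) :
  depth T = n -> (forall u : T, leaf u -> generation u = n) ->
  forall u : T, exists2 b, fconnect (@parent T) b u & generation b = n.
Proof.
move=> hdepth hleaf u; have [k] := ubnP (depth T - generation u).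
elim: k u => // k IH u uk.
have [/hleaf un|] := boolP (leaf u); first by exists u; rewrite ?connect0.
rewrite negb_forall => /existsP[v]; rewrite negbK => vu.
have [|b bv bn] := IH v.
  by have := generation_leq_depth v; rewrite (generation_child vu); lia.
by exists b => //; apply: connect_trans bv (child_desc vu).
Qed.

Theorem proposition2p1 (R : realType) (p q : R) (T : rtree) (n : nat)
    (hp : 0 <= p <= 1) (hq : 0 < q)
    (hdepth : depth T = n)
    (hleaf : forall u : T, leaf u -> generation u = n) :
  [/\ (forall u : T, generation u = n -> pi_wired p q n u = 1),
      (forall u : T, generation u <> n ->
         phi q (pi_wired p q n u) =
           \prod_(v : T | child v u) phi q (gamma_pq p q * pi_wired p q n v)),
      (forall u : T, generation u = n -> B_wired p q n u = +oo%E),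
      (forall beta : \bar R, (0 <= beta)%E ->
         (1 - p)%:E = expeR (- beta)%E ->
         forall u : T, generation u <> n ->
           B_wired p q n u =
             (\sum_(v : T | child v u)
                psi_inv q (psi q beta * psi q (B_wired p q n v)))%E)
    & (forall x : \bar R, (0 <= x)%E ->
         psi q x = phi q (fine (expeR (- x)%E)))].
Proof.
have below := boundary_below hdepth hleaf.
split=> [u un|u /eqP un|u un|beta beta0 hbeta u /eqP un|x x0].
- exact: pi_wired_boundary.
- exact: phi_pi_wired_rec.
- by rewrite /B_wired pi_wired_boundary // /phi subrr mul0r le0_lneNy.
- exact: B_wired_rec.
- exact: psi_expeR.
Qed.
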